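(* Let $c = \min\left\{ \dfrac{x-p}{x-p^{x}} : x \ge 1,\ p\in(0,1)\right\}$, whose decimal expansion begins $c = 0.853195\ldots$. For every instance $I$ of the Unreliable Job scheduling Problem (with any number $m$ of machines), $\lambda(I) \ge c = 0.853195\ldots$, where $\lambda(I)$ is the ratio of the expected reward of the primary Largest-Z-ratio-First schedule of $I$ to the optimal expected reward of $I$.
   Context: Unreliable Job scheduling Problem (UJP). An instance $I$ consists of a number $m\ge 1$ of identical parallel machines $M_1,\dots,M_m$, a finite nonempty set of jobs, where each job $j$ has a success probability $\pi_j$, a rational number with $0<\pi_j<1$, and a reward $r_j\ge 0$ (not all rewards zero), together with a chosen LZF order of the jobs (defined below). A schedule $S$ assigns each job to exactly one machine and orders the jobs on each machine; a machine may be empty. For a schedule and a job $j$, the cumulative probability $P_j$ of job $j$ is the product of the success probabilities of all jobs on the same machine as $j$ up to and including $j$. The expected reward of $S$ is $ER[S]=\sum_j r_j P_j$. $S_{OPT}(I)$ denotes a schedule of maximum expected reward. The Z-ratio of job $j$ is $Z_j=\dfrac{\pi_j r_j}{1-\pi_j}$. An LZF order is an ordering of all the jobs by non-increasing $Z_j$ (ties ordered arbitrarily; the chosen order is part of the instance). The Largest-Z-ratio-First (LZF) algorithm takes the jobs in this order and appends each one to the end of the current sequence of a machine currently having maximum cumulative probability, where the (current) cumulative probability of a machine is the product of the success probabilities of the jobs already scheduled on it (equal to $1$ for an empty machine); ties between machines are broken arbitrarily, which only affects the result up to relabelling machines. The resulting schedule is the primary LZF schedule $S_{LZF}(I)$.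 Finally, $\lambda(I)=\dfrac{ER[S_{LZF}(I)]}{ER[S_{OPT}(I)]}$. *)

(* Defs.v *)
From HB Require Import structures.
From mathcomp Require Import all_boot all_order all_algebra.
From mathcomp Require Import classical_sets reals exp.

Set Implicit Arguments.
Unset Strict Implicit.
Unset Printing Implicit Defensive.

Import Order.TTheory GRing.Theory Num.Theory.
Local Open Scope ring_scope.

Definition Z_ratio (R : realType) (p : rat) (r : R) : R :=
  ratr p * r / (1 - ratr p).

Record instance (R : realType) := Instance {
  machines : nat;
  machines_gt0 : (0 < machines)%N;
  job : finType;
  job_gt0 : (0 < #|job|)%N;
  prob : job -> rat;
  prob_gt0 : forall j, 0 < prob j;
  prob_lt1 : forall j, prob j < 1;
  reward : job -> R;
  reward_ge0 : forall j, 0 <= reward j;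
  reward_neq0 : exists j, reward j != 0;
  lzf_order : seq job;
  lzf_order_uniq : uniq lzf_order;
  lzf_order_all : forall j, j \in lzf_order;
  lzf_order_sorted :
    sorted (fun j k => Z_ratio (prob k) (reward k)
                       <= Z_ratio (prob j) (reward j)) lzf_order
}.

Section Scheduling.
Variables (R : realType) (I : instance R).

(* The sequence of jobs on each machine, possibly covering only some jobs. *)
Definition queues := {ffun 'I_(machines I) -> seq (job I)}.

Implicit Types (S q : queues) (i : 'I_(machines I)) (j k : job I).

Definition is_schedule S : Prop :=
  (forall i, uniq (S i)) /\ (forall j, exists! i, j \in S i).

(* k is on the same machine as j, at or before j. *)
Definition up_to S j k : bool :=
  [exists i, [&& k \in S i, j \in S i & (index k (S i) <= index j (S i))%N]].

Definition job_cumprob S j : rat := \prod_(k | up_to S j k) prob k.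

Definition ER S : R := \sum_j reward j * ratr (job_cumprob S j).

Definition is_optimal S : Prop :=
  is_schedule S /\ forall S', is_schedule S' -> ER S' <= ER S.

Definition machine_cumprob q i : rat := \prod_(j <- q i) prob j.

Definition append q i j : queues :=
  [ffun i' => if i' == i then rcons (q i') j else q i'].

(* lzf_run s q S: S can be obtained from q by processing the jobs of s in turn.
   It is a relation because ties between machines are broken arbitrarily. *)
Fixpoint lzf_run (s : seq (job I)) q S : Prop :=
  if s is j :: s' then
    exists2 i, (forall i', machine_cumprob q i' <= machine_cumprob q i)
             & lzf_run s' (append q i j) S
  else S = q.

Definition is_LZF S : Prop := lzf_run (lzf_order I) [ffun => [::]] S.

Definition lambda S_LZF S_OPT : R := ER S_LZF / ER S_OPT.


Lemma lzf_run_total s q : exists S, lzf_run s q S.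
Proof.
elim: s q => [|j s IHs] q /=; first by exists q.
pose i0 := Ordinal (machines_gt0 I).
case: (Order.TotalTheory.arg_maxP (machine_cumprob q) (erefl : xpredT i0)).
move=> i _ imax; have [S HS] := IHs (append q i j).
by exists S, i => // i'; apply: imax.
Qed.

Lemma is_LZF_exists : exists S, is_LZF S.
Proof. exact: lzf_run_total. Qed.

Lemma lzf_run_schedule s q S : uniq s ->
    (forall i, uniq (q i)) ->
    (forall j, if j \in s then forall i, j \notin q i
               else exists! i, j \in q i) ->
  lzf_run s q S -> is_schedule S.
Proof.
elim: s q => [|j s IHs] q /=; first by move=> _ uq hq ->.
case/andP=> js us uq hq [i _]; apply: IHs => // [i'|k].
  rewrite ffunE; case: ifP => // _; rewrite rcons_uniq uq andbT.
  by have := hq j; rewrite mem_head => /(_ i').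
have := hq k; rewrite inE; case: (eqVneq k j) => [->|kj] /=.
  rewrite (negPf js) => jq; exists i; split=> [|i'].
    by rewrite ffunE eqxx mem_rcons mem_head.
  by rewrite ffunE; case: (eqVneq i' i) => // _; rewrite (negPf (jq i')).
have E i' : (k \in append q i j i') = (k \in q i').
  by rewrite ffunE; case: ifP => // _; rewrite mem_rcons inE (negPf kj).
case: ifP => _; first by move=> h i'; rewrite E.
by case=> i0 [h0 u0]; exists i0; split=> [|i']; rewrite E //; apply: u0.
Qed.

Lemma is_LZF_schedule S : is_LZF S -> is_schedule S.
Proof.
apply: lzf_run_schedule => [|i|j]; first exact: lzf_order_uniq.
  by rewrite ffunE.
by rewrite lzf_order_all => i; rewrite ffunE.
Qed.

Lemma is_optimal_exists : exists S, is_optimal S.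
Proof.
pose T := {ffun 'I_(machines I) -> #|job I|.-bseq (job I)}.
pose toS (t : T) : queues := [ffun i => t i : seq _].
pose P (t : T) := [forall i, uniq (toS t i)] &&
  [forall j, #|[pred i | j \in toS t i]| == 1%N].
have PP t : reflect (is_schedule (toS t)) (P t).
  apply: (iffP andP) => [[/forallP h1 /forallP h2]|[h1 h2]].
    split=> // j; have /card1P [i hi] := h2 j; exists i; split.
      by have := hi i; rewrite !inE eqxx.
    by move=> i'; have := hi i'; rewrite !inE => -> /eqP ->.
  split; first by apply/forallP.
  apply/forallP => j; apply/card1P; have [i [ij iu]] := h2 j.
  exists i => i'; rewrite !inE; apply/idP/eqP => [/iu //|->//].
have surj S : is_schedule S -> exists t, toS t = S.
  case=> uS _; have sz i : (size (S i) <= #|job I|)%N.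
    by rewrite -(card_uniqP (uS i)) max_card.
  exists [ffun i => Bseq (sz i)]; apply/ffunP => i.
  by rewrite !ffunE.
have [S0 /is_LZF_schedule HS0] := is_LZF_exists.
have [t0 Et0] := surj _ HS0.
have Pt0 : P t0 by apply/PP; rewrite Et0.
case: (Order.TotalTheory.arg_maxP (fun t => ER (toS t)) Pt0) => t /PP Pt tmax.
exists (toS t); split=> // S' HS'; have [t' Et'] := surj _ HS'.
by rewrite -Et'; apply: tmax; apply/PP; rewrite Et'.
Qed.

End Scheduling.

Local Open Scope classical_set_scope.

Definition ratio_values (R : realType) : set R :=
  [set y | exists x p : R,
     [/\ 1 <= x, 0 < p < 1 & y = (x - p) / (x - p `^ x)]].

Definition is_min (R : realType) (A : set R) (c : R) : Prop :=
  A c /\ lbound A c.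

(* Main.v *)
Require Import Defs.
From mathcomp Require Import all_boot all_order all_algebra.
From mathcomp Require Import ring lra.
From mathcomp Require Import classical_sets reals exp.
From mathcomp Require Import topology normedtype sequences derive.
Import Order.TTheory GRing.Theory Num.Theory.
Import numFieldNormedType.Exports.
Local Open Scope classical_set_scope.
Local Open Scope ring_scope.

(** Write [a_j = - ln pi_j >= 0], so that a machine whose jobs have total load
    [x] survives with probability [exp (- x)]. Since
    [r_j * pi_j = Z_j * (1 - pi_j)], job [j] contributes [Z_j] times the drop
    (its loss) that it causes in the cumulative probability of its machine, and
    the expected reward of a schedule is the sum of [Z_j] times the loss of
    [j].

    The LZF order has non-increasing [Z_j], so by Abel summation
    ([abel_sum_ge0]) it is enough to compare the sums of losses over every
    prefix [A] of that order. In any schedule this sum is at most the sum over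
    machines of [1 - exp (- load)], where only the jobs of [A] count as load
    ([sum_loss_le]), and in the LZF schedule it is at least that quantity
    ([sum_loss_ge]), because the jobs of [A] come first on every machine. The
    rewards have now disappeared: it remains to show that list scheduling,
    which always serves a least loaded machine, gets at least [c] times the
    value [\sum_i (1 - exp (- load_i))] of any other partition of the same jobs
    ([balanced_greedy_bound]).

    Let [s] be the least load of the greedy partition. On machine [i] let [b_i]
    be the last job and [h_i] the load before it; greediness says
    [h_i <= s <= h_i + b_i]. The competing partition is relaxed by letting all
    jobs but the [b_i] be split at will; this fluid fills the machines up to a
    common water level [w], with [\sum_i max(0, w - b_i) = \sum_i h_i]
    ([water_level]), so the competitor gets at most
    [\sum_i (1 - exp (- max(b_i, w)))]. This is weak duality for the water
    filling problem, and [gain_bound] is its price function. Finally the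
    desired inequality between the two sums is proved machine by machine after
    adding [nu * (max(0, w - b_i) - h_i)], which sums to zero, for a suitable
    multiplier [nu] ([multiplier_exists], [machine_bound]): by convexity of the
    exponential only the extreme machines [(h, b) = (s, 0)], [(s, w)] and
    [(s, oo)] matter. The binding case amounts to
    [p <= (1 - c) * x + c * p `^ x] for [x = w / s] and [p = exp (- s)], which
    is what the choice of [c] ensures.

    The minimum [c] exists because the ratio is at least [86 / 100] outside a
    compact rectangle. For its numerical value, weighted AM-GM reduces the
    inequality in [x] and [p] to one in [x] alone ([powR_chord_ge]), and the
    logarithms there are bounded below by tangents ([ln_ge_tangent]), which
    leaves cubic polynomial inequalities ([powR_chord_numeric]). *)

(** * Bounds on the exponential and the logarithm *)

Lemma series_expR_le (R : realType) (n : nat) (x : R) :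
  0 <= x -> series (exp_coeff x) n <= expR x.
Proof.
move=> x0; apply: nondecreasing_cvgn_le; last exact: is_cvg_series_exp_coeff.
by apply: nondecreasing_series => k _ _; exact: exp_coeff_ge0.
Qed.

(** From rank [n] on, consecutive terms of the series have ratio at most
    [1 / 2], so the tail is at most twice its first term. *)
Lemma expR_le_series (R : realType) (n : nat) (x : R) :
  0 <= x -> 2 * x <= n.+1%:R ->
  expR x <= series (exp_coeff x) n + 2 * exp_coeff x n.
Proof.
move=> x0 xn; apply: limr_le; first exact: is_cvg_series_exp_coeff.
have step k : (n <= k)%N ->
    series (exp_coeff x) k + 2 * exp_coeff x k
      <= series (exp_coeff x) n + 2 * exp_coeff x n.
  elim: k => [|k IHk]; first by rewrite leqn0 => /eqP ->.
  rewrite leq_eqVlt => /orP[/eqP <- //|]; rewrite ltnS => nk.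
  apply: le_trans (IHk nk).
  rewrite /series /= big_nat_recr //= -addrA lerD2l.
  have -> : exp_coeff x k.+1 = exp_coeff x k * (x / k.+1%:R).
    by rewrite /exp_coeff /= factS natrM exprS invfM; ring.
  have ck := exp_coeff_ge0 k x0.
  have xk : x / k.+1%:R <= 2^-1.
    rewrite ler_pdivrMr ?ltr0n// ler_pdivlMl ?ltr0n//.
    by apply: le_trans xn _; rewrite ler_nat ltnS.
  by have := ler_wpM2l ck xk; move: (_ * (x / _)) => z; lra.
exists n => // k /= /step; apply: le_trans.
by rewrite lerDl mulr_ge0 ?exp_coeff_ge0.
Qed.

(** The exponential lies above its tangent, read at [a - ln u]. With [a] close
    to [ln u] the bound is sharp to second order, and it needs only a numerical
    upper bound [E] of [expR a]. *)
Lemma ln_ge_tangent (R : realType) (a E u : R) :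
  0 < u -> expR a <= E -> a + 1 - E / u <= ln u.
Proof.
move=> u0 aE; have := expR_ge1Dx (a - ln u).
rewrite expRB lnK ?posrE// => h.
have : expR a / u <= E / u by rewrite ler_pM2r ?invr_gt0.
lra.
Qed.

(** Both exponentials are bounded below by the tangent at the mean point. *)
Lemma expR_conv (R : realType) (t a b : R) :
  0 <= t <= 1 -> expR (t * a + (1 - t) * b) <= t * expR a + (1 - t) * expR b.
Proof.
case/andP=> t0 t1; set w := t * a + _.
have tangent y : expR w * (1 + (y - w)) <= expR y.
  rewrite -[y in leRHS](subrKC w) (expRD w (y - w)) ler_pM2l ?expR_gt0//.
  exact: expR_ge1Dx.
have ha := ler_wpM2l t0 (tangent a).
have hb : (1 - t) * (expR w * (1 + (b - w))) <= (1 - t) * expR b.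
  by rewrite ler_wpM2l ?subr_ge0.
apply: le_trans (lerD ha hb).
suff -> : t * (expR w * (1 + (a - w))) + (1 - t) * (expR w * (1 + (b - w)))
  = expR w by [].
by rewrite /w; ring.
Qed.

Lemma bernoulli_powR (R : realType) (x p : R) :
  1 <= x -> 0 < p -> 1 + x * (p - 1) <= p `^ x.
Proof.
move=> x1 p0; have x0 : 0 < x by lra.
have := @expR_conv R x^-1 (ln (p `^ x)) 0.
rewrite invr_ge0 invf_le1// (ltW x0) x1 => /(_ isT).
rewrite mulr0 addr0 expR0 (lnK (powR_gt0 _ p0)).
rewrite ln_powR mulKf ?gt_eqF// lnK ?posrE//.
rewrite -(ler_pM2l x0).
have -> : x * (x^-1 * p `^ x + (1 - x^-1) * 1) = p `^ x + x - 1.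
  by field; rewrite gt_eqF.
lra.
Qed.

(** * Numerical lower bound on the ratio *)

(** Weighted AM-GM, with weights [1 - 1 / x] and [1 / x] applied to
    [(1 - c) * x ^+ 2 / (x - 1)] and [c * x * p `^ x]: the exponents are chosen
    so that the geometric mean is [p] times a function of [x] alone. *)
Lemma powR_chord_ge (R : realType) (c x p : R) :
  0 < c < 1 -> 1 < x -> 0 < p ->
  0 <= (x - 1) * ln ((1 - c) * x ^+ 2 / (x - 1)) + ln (c * x) ->
  p <= (1 - c) * x + c * p `^ x.
Proof.
case/andP=> c0 c1 x1 p0.
have x0 : 0 < x by lra.
have y0 : 0 < x - 1 by lra.
set u := _ / _ => K0.
have u0 : 0 < u by rewrite divr_gt0// mulr_gt0 ?exprn_gt0// subr_gt0.
have px0 : 0 < p `^ x by exact: powR_gt0.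
have cx0 : 0 < c * x by exact: mulr_gt0.
have v0 : 0 < c * x * p `^ x by exact: mulr_gt0.
have := @expR_conv R x^-1 (ln (c * x * p `^ x)) (ln u).
rewrite invr_ge0 invf_le1// (ltW x0) (ltW x1) => /(_ isT).
rewrite !lnK ?posrE//.
have -> : x^-1 * (c * x * p `^ x) + (1 - x^-1) * u
    = (1 - c) * x + c * p `^ x.
  by rewrite /u; field; rewrite !gt_eqF.
apply: le_trans; rewrite -[leLHS]lnK ?posrE// ler_expR.
rewrite lnM ?posrE// ln_powR -(ler_pM2l x0).
have -> : x * (x^-1 * (ln (c * x) + x * ln p) + (1 - x^-1) * ln u) =
  x * ln p + ((x - 1) * ln u + ln (c * x)).
  by field; rewrite gt_eqF.
by rewrite lerDl.
Qed.

(** Tangent bounds for both logarithms, multiplied by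
    [c * (1 - c) * (1 + y) ^+ 2], turn the expression in [powR_chord_ge], at
    [x = 1 + y], into a cubic polynomial. *)
Lemma log_form_ge0 (R : realType) (c a b Ea Eb y : R) :
  0 < c < 1 -> 0 < y -> expR a <= Ea -> expR b <= Eb ->
  0 <= c * (1 - c) * ((a + 1) * y + (b + 1)) * (1 + y) ^+ 2
       - c * Ea * y ^+ 2 - (1 - c) * Eb * (1 + y) ->
  0 <= y * ln ((1 - c) * (1 + y) ^+ 2 / y) + ln (c * (1 + y)).
Proof.
case/andP=> c0 c1 y0 aE bE.
have x0 : 0 < 1 + y by lra.
have d0 : 0 < 1 - c by lra.
have u0 : 0 < (1 - c) * (1 + y) ^+ 2 / y.
  by rewrite divr_gt0// mulr_gt0// exprn_gt0.
have v0 : 0 < c * (1 + y) by exact: mulr_gt0.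
have hu := ler_wpM2l (ltW y0) (ln_ge_tangent _ _ _ _ u0 aE).
have hv := ln_ge_tangent _ _ _ _ v0 bE.
move=> P0; apply: le_trans (lerD hu hv).
suff -> : y * (a + 1 - Ea / ((1 - c) * (1 + y) ^+ 2 / y)) +
    (b + 1 - Eb / (c * (1 + y)))
  = (c * (1 - c) * ((a + 1) * y + (b + 1)) * (1 + y) ^+ 2
       - c * Ea * y ^+ 2 - (1 - c) * Eb * (1 + y))
    / (c * (1 - c) * (1 + y) ^+ 2).
  by rewrite divr_ge0// !mulr_ge0 ?exprn_ge0// ltW.
by field; rewrite !gt_eqF.
Qed.

Lemma series_exp_coeff8 (R : realType) (x : R) :
  series (exp_coeff x) 8%N =
  1 + x + x ^+ 2 / 2 + x ^+ 3 / 6 + x ^+ 4 / 24 + x ^+ 5 / 120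
    + x ^+ 6 / 720 + x ^+ 7 / 5040.
Proof.
have e k n : (k`! = n)%N -> exp_coeff x k = x ^+ k / n%:R by move=> <-.
rewrite seriesEnat [LHS]/mk_sequence !big_nat_recr // big_geq //= add0r.
rewrite (e 0 1)%N // (e 1 1)%N // (e 2 2)%N // (e 3 6)%N // (e 4 24)%N //.
by rewrite (e 5 120)%N // (e 6 720)%N // (e 7 5040)%N // expr0 expr1 !divr1.
Qed.

Lemma expR_le_taylor8 (R : realType) (x : R) :
  0 <= x <= 1 ->
  expR x <= 1 + x + x ^+ 2 / 2 + x ^+ 3 / 6 + x ^+ 4 / 24 + x ^+ 5 / 120
    + x ^+ 6 / 720 + x ^+ 7 / 5040 + x ^+ 8 / 5040 / 4.
Proof.
case/andP=> x0 x1.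
have x9 : 2 * x <= 9%:R by lra.
apply: le_trans (expR_le_series _ 8%N _ x0 x9) _.
have -> : exp_coeff x 8%N = x ^+ 8 / (5040 * 8).
  by rewrite /exp_coeff /= factS mulnC natrM.
by rewrite series_exp_coeff8; lra.
Qed.

Lemma expRN_le_taylor8 (R : realType) (x E : R) :
  0 <= x -> 0 < E ->
  1 <= (1 + x + x ^+ 2 / 2 + x ^+ 3 / 6 + x ^+ 4 / 24 + x ^+ 5 / 120
    + x ^+ 6 / 720 + x ^+ 7 / 5040) * E ->
  expR (- x) <= E.
Proof.
move=> x0 E0; rewrite -series_exp_coeff8 => h.
rewrite expRN -[leRHS]invrK lef_pV2 ?posrE ?expR_gt0 ?invr_gt0//.
apply: le_trans (series_expR_le _ 8%N _ x0).
by rewrite -div1r ler_pdivrMr.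
Qed.

(** The expression with logarithms in [powR_chord_ge] has a minimum of a few
    [10 ^- 6] near [x = 2.123], so tangent points there must be accurate; away
    from it coarse ones do. *)
Lemma powR_chord_numeric (R : realType) (x p : R) :
  1 <= x -> 0 < p < 1 ->
  p <= (1 - 853195%:R / 10 ^+ 6) * x + 853195%:R / 10 ^+ 6 * p `^ x.
Proof.
move=> x1 /andP[p0 p1].
(* Near [x = 1] the expression with logarithms is negative, but there [p <= 1]
   makes Bernoulli's inequality sufficient. *)
have [cx1|cx1] := lerP (853195%:R / 10 ^+ 6 * x) 1.
  have := bernoulli_powR _ _ _ x1 p0; move: (p `^ x) => q hq.
  have : 0 <= (1 - 853195%:R / 10 ^+ 6 * x) * (1 - p).
    by rewrite mulr_ge0// subr_ge0// ltW.
  lra.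
have c01 : 0 < (853195%:R / 10 ^+ 6 : R) < 1 by apply/andP; split; lra.
have [y y0 xE] : exists2 y, 0 < y & x = 1 + y by exists (x - 1); lra.
rewrite {}xE {x x1} in cx1 *.
apply: powR_chord_ge => //; first by lra.
have -> : 1 + y - 1 = y by ring.
(* The tangent exponents [a] and [b] approximate the two logarithms at some
   point of the range: [0] and [0] near [y = 0.2], [- 0.5] and [0.44] in the
   middle, [- 0.529] and [0.594] at the critical [y = 1.123].  The first two
   cubics are concave on their ranges, hence handled by products of the
   distances to two points that enclose the range. *)
have [y2|y2] := lerP y (2 / 5).
  apply: (@log_form_ge0 _ _ 0 0 1 1) => //; rewrite ?expR0//.
  have : 0 <= (y - 17 / 100) * (2 / 5 - y) by rewrite mulr_ge0; lra.
  have : 0 <= (y - 17 / 100) * (2 / 5 - y) * (2 / 5 - y).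
    by rewrite !mulr_ge0; lra.
  lra.
have [y3|y3] := lerP y (95 / 100).
  have ea : expR (- (1 / 2)) <= 6066%:R / 10 ^+ 4 :> R.
    by apply: expRN_le_taylor8; lra.
  have eb : expR (44 / 100) <= 15528%:R / 10 ^+ 4 :> R.
    by apply: le_trans (expR_le_taylor8 _ _ _) _; [apply/andP; split|]; lra.
  apply: (@log_form_ge0 _ _ _ _ _ _ _ c01 y0 ea eb).
  have h1 : 0 <= (y - 2 / 5) * (95 / 100 - y) by rewrite mulr_ge0//; lra.
  have h2 : 0 <= (y - 2 / 5) * (95 / 100 - y) * (95 / 100 - y).
    by rewrite mulr_ge0//; lra.
  lra.
have ea : expR (- (529 / 1000)) <= 589194%:R / 10 ^+ 6 :> R.
  by apply: expRN_le_taylor8; lra.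
have eb : expR (594 / 1000) <= 181122%:R / 10 ^+ 5 + 6 / 10 ^+ 7 :> R.
  by apply: le_trans (expR_le_taylor8 _ _ _) _; [apply/andP; split|]; lra.
apply: (@log_form_ge0 _ _ _ _ _ _ _ c01 y0 ea eb).
(* [1.1241] is nearly a double root of the last cubic. *)
have h1 : 0 <= (y - 11241%:R / 10 ^+ 4) ^+ 2 by exact: sqr_ge0.
have h2 : 0 <= (y - 11241%:R / 10 ^+ 4) ^+ 2
               * (471 / 10 ^+ 3 * y - 4185443%:R / 10 ^+ 7).
  by rewrite mulr_ge0//; lra.
lra.
Qed.

(** * The minimum of the ratio *)

Lemma ratio_ge (R : realType) (c x p : R) :
  1 <= x -> 0 < p < 1 ->
  (c <= (x - p) / (x - p `^ x)) = (p <= (1 - c) * x + c * p `^ x).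
Proof.
move=> x1 /andP[p0 p1].
have q1 : p `^ x <= p by rewrite ge1r_powR// p0 ltW.
rewrite ler_pdivlMr; last by lra.
by apply/idP/idP => h; lra.
Qed.

Lemma ratio_values_small (R : realType) :
  exists x p : R, [/\ 1 <= x <= 8, 14 / 100 <= p <= 86 / 100
    & (x - p) / (x - p `^ x) < 853196%:R / 10 ^+ 6].
Proof.
(* Rational approximations of the minimiser [x = 2.1231...], [p = 0.5892...];
   the denominator [8] makes [p `^ x] comparable to rationals by raising to the
   power [8]. *)
exists (17 / 8), (589 / 1000); split; [by apply/andP; split; lra..|].
set p : R := 589 / 1000.
have p0 : 0 < p by rewrite /p; lra.
have q0 : 0 <= p `^ (17 / 8) by exact: powR_ge0.
have q8 : (p `^ (17 / 8)) ^+ 8 = p ^+ 17.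
  rewrite -powR_mulrn// -powRrM -[RHS]powR_mulrn ?ltW//.
  by congr (_ `^ _); lra.
have q1 : p `^ (17 / 8) < 32471%:R / 10 ^+ 5.
  by rewrite -(@ltr_pXn2r _ 8) ?nnegrE ?q8// /p; lra.
rewrite ltr_pdivrMr /p; lra.
Qed.

(** The ratio is continuous on the compact rectangle [A], takes there a value
    below [86 / 100], and is at least [86 / 100] outside [A]; staying away from
    [(1, 1)], where it is undefined, is what makes the compactness argument
    work. *)
Lemma ratio_values_has_min (R : realType) :
  exists c, is_min (@ratio_values R) c /\ c < 853196%:R / 10 ^+ 6.
Proof.
pose f (u : R * R) : R := (u.1 - u.2) / (u.1 - expR (u.1 * ln u.2)).
pose A : set (R * R) := `[1, 8] `*` `[14 / 100, 86 / 100].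
have [x0 [p0 [x08 p086 small]]] := ratio_values_small R.
have fE x p : 0 < p -> f (x, p) = (x - p) / (x - p `^ x).
  by move=> p_gt0; rewrite /f /powR gt_eqF.
have A0 : A (x0, p0) by split; rewrite /= in_itv.
have cA : compact A by apply: compact_setX; exact: segment_compact.
have cf : {within A, continuous f}.
  apply: continuous_in_subspaceT => -[x p]; rewrite inE => -[] /=.
  rewrite !in_itv /= => /andP[x1 _] /andP[p1 p2].
  have p_gt0 : 0 < p by lra.
  have den : x - expR (x * ln p) != 0.
    have := @ge1r_powR R p x; rewrite /powR (gt_eqF p_gt0) p_gt0 => h.
    by rewrite gt_eqF//; have := h _ x1; lra.
  rewrite /continuous_at /f /=; apply: cvgM.
    by apply: cvgB; [exact: cvg_fst|exact: cvg_snd].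
  apply: cvgV => //; apply: cvgB; first exact: cvg_fst.
  apply: continuous_cvg; first exact: continuous_expR.
  apply: cvgM; first exact: cvg_fst.
  apply: continuous_cvg; [exact: continuous_ln|exact: cvg_snd].
have [[x p] /set_mem[/= Ax Ap] fmin] :=
  compact_EVT_min (ex_intro _ _ A0) cA cf.
move: Ax Ap; rewrite !in_itv /= => /andP[x1 x8] /andP[p14 p86].
have p_gt0 : 0 < p by lra.
have fsmall : f (x, p) < 853196%:R / 10 ^+ 6.
  apply: le_lt_trans small.
  rewrite -fE; last by lra.
  by apply: fmin; rewrite inE.
exists (f (x, p)); split=> //; split.
  exists x, p; split=> //; last by rewrite fE.
  by rewrite p_gt0; lra.
move=> _ [y [q [y1 q01 ->]]].
have /andP[q_gt0 q_lt1] := q01.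
have outside : q <= (1 - 86 / 100) * y + 86 / 100 * q `^ y ->
    f (x, p) <= (y - q) / (y - q `^ y).
  by rewrite -ratio_ge//; apply: le_trans; lra.
have [q14|q14] := lerP q (14 / 100).
  by apply: outside; have := powR_ge0 q y; lra.
have [y8|y8] := lerP 8 y; first by apply: outside; have := powR_ge0 q y; lra.
have [q86|q86] := lerP q (86 / 100).
  rewrite -fE//; apply: fmin; rewrite inE; split; rewrite /= in_itv /=.
    by rewrite y1 ltW.
  by rewrite ltW.
apply: outside.
have := bernoulli_powR _ _ _ y1 q_gt0.
(* [84 / 100] only has to lie between [1 - 14 / 86] and [86 / 100]. *)
have : 0 <= (y - 1) * (q - 84 / 100) by rewrite mulr_ge0//; lra.
lra.
Qed.

(** * The multiplier argument on one machine *)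

Lemma expRN_chord (R : realType) (s w : R) :
  0 < w -> 0 <= s <= w -> w * expR (- s) <= w - s * (1 - expR (- w)).
Proof.
move=> w0 /andP[s0 sw].
have := @expR_conv R (s / w) (- w) 0.
rewrite divr_ge0 ?(ltW w0)// ler_pdivrMr// mul1r sw => /(_ isT).
rewrite mulr0 addr0 mulrN divfK ?gt_eqF// expR0 -(ler_pM2l w0).
have -> : w * (s / w * expR (- w) + (1 - s / w) * 1)
    = w - s * (1 - expR (- w)) by field; rewrite gt_eqF.
by [].
Qed.

(** The three conditions are the machine inequality at the extreme pairs
    [(h, b) = (s, 0)], [(s, w)] and [(s, oo)], where the coefficient of [nu] is
    [w - s], [- s] and [- s]. The last two are upper bounds on [nu], and [nu]
    is taken as large as they allow; which of them binds depends on whether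
    [expR (- s)] exceeds [c]. If it does not, the first condition is exactly
    the hypothesis on [c]; if it does, it follows from [expRN_chord]. *)
Lemma multiplier_exists (R : realType) (c s w : R) :
  0 < c < 1 -> 0 <= s <= w ->
  s * expR (- s) <= (1 - c) * w + c * s * expR (- w) ->
  exists nu,
    [/\ 0 <= 1 - expR (- s) - c * (1 - expR (- w)) + nu * (w - s),
        0 <= 1 - expR (- s) * expR (- w) - c * (1 - expR (- w)) - nu * s
      & 0 <= 1 - c - nu * s].
Proof.
case/andP=> c0 c1 /andP[s0 sw] Hc.
have q0 := expR_gt0 (- w).
have q1 : expR (- w) <= 1 by rewrite expR_le1; lra.
have p0 := expR_gt0 (- s).
have p1 : expR (- s) <= 1 by rewrite expR_le1; lra.
move: s0; rewrite le_eqVlt => /orP[/eqP s0|s0].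
  (* If [s = 0], the upper bounds on [nu] are vacuous. *)
  exists c; rewrite -{}s0 oppr0 expR0 in Hc *.
  have := expR_ge1Dx (- w); move: (expR (- w)) q0 q1 => q q0 q1 hq.
  split; nra.
have w0 : 0 < w by lra.
have chord : w * expR (- s) <= w - s * (1 - expR (- w)).
  by apply: expRN_chord => //; rewrite (ltW s0).
move: (expR (- s)) (expR (- w)) p0 p1 q0 q1 Hc chord.
move=> p q p0 p1 q0 q1 Hc chord.
have [pc|cp] := lerP p c.
  exists ((1 - c) / s); rewrite divfK ?gt_eqF//; split; [|nra|lra].
  rewrite -(pmulr_rge0 _ s0).
  have -> : s * (1 - p - c * (1 - q) + (1 - c) / s * (w - s)) =
    (1 - c) * w + c * s * q - s * p by field; rewrite gt_eqF.
  by rewrite subr_ge0.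
exists ((1 - p * q - c * (1 - q)) / s); rewrite divfK ?gt_eqF//.
split; [|lra|nra].
rewrite -(pmulr_rge0 _ s0).
have -> : s * (1 - p - c * (1 - q) + (1 - p * q - c * (1 - q)) / s * (w - s)) =
  (w * (1 - p) - s * (1 - q)) + w * (1 - q) * (p - c) + s * (1 - q) * (1 - p).
  by field; rewrite gt_eqF.
have h1 : 0 <= w * (1 - q) * (p - c).
  by rewrite !mulr_ge0 ?subr_ge0 ?(ltW w0) ?(ltW cp).
have h2 : 0 <= s * (1 - q) * (1 - p) by rewrite !mulr_ge0 ?subr_ge0 ?(ltW s0).
lra.
Qed.

(** If [b < w], the expression depends only on [h + b], which lies in
    [[s, s + w]], and is concave in it, so the end points decide. If [b >= w],
    it is concave in [h] between [0] and [s], and for [h = s] it is affine in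
    [expR (- b)] between [0] and [expR (- w)]. *)
Lemma machine_bound (R : realType) (c s w nu h b : R) :
  0 < c < 1 -> 0 <= h <= s -> s <= h + b -> 0 <= b -> s <= w ->
  0 <= 1 - expR (- s) - c * (1 - expR (- w)) + nu * (w - s) ->
  0 <= 1 - expR (- s) * expR (- w) - c * (1 - expR (- w)) - nu * s ->
  0 <= 1 - c - nu * s ->
  0 <= 1 - expR (- (h + b)) - c * (1 - expR (- Num.max b w))
       + nu * (Num.max 0 (w - b) - h).
Proof.
case/andP=> c0 c1 /andP[h0 hs] shb b0 sw A B C.
have [bw|wb] := ltP b w.
  rewrite max_r; last by lra.
  have w0 : 0 < w by lra.
  have t01 : 0 <= (h + b - s) / w <= 1.
    by rewrite divr_ge0 ?ler_pdivrMr ?mul1r//; lra.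
  have := @expR_conv R _ (- s - w) (- s) t01; move: t01 => /andP[t0 t1].
  have zE : (h + b - s) / w * w = h + b - s by rewrite divfK// gt_eqF.
  move: ((h + b - s) / w) t0 t1 zE => t t0 t1 zE.
  have -> : t * (- s - w) + (1 - t) * - s = - (h + b).
    by rewrite (_ : h + b = t * w + s); lra.
  rewrite (expRD (- s)) => conv.
  have A' := mulr_ge0 (_ : 0 <= 1 - t) A; have B' := mulr_ge0 t0 B.
  have {A'} := A' _; rewrite subr_ge0 => /(_ t1) A'.
  have -> : w - b - h = w - s - t * w by lra.
  lra.
rewrite max_l; last by lra.
have q0 := expR_gt0 (- w); have qb0 := expR_gt0 (- b).
have qb : expR (- b) <= expR (- w) by rewrite ler_expR; lra.
have qb1 : expR (- b) <= 1 by rewrite expR_le1; lra.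
rewrite sub0r mulrN opprD expRD.
move: (expR (- b)) qb qb0 qb1 => r qb qb0 qb1.
have T0 : 0 <= (1 - c) * (1 - r) by rewrite mulr_ge0; lra.
have Ts : 0 <= 1 - c - nu * s - r * (expR (- s) - c).
  have B' := mulr_ge0 (ltW qb0) B.
  have := mulr_ge0 (_ : 0 <= expR (- w) - r) C.
  rewrite subr_ge0 => /(_ qb) C'.
  rewrite -(pmulr_rge0 _ q0); lra.
have : 0 <= s by lra.
rewrite le_eqVlt => /orP[/eqP s0|s0].
  have -> : h = 0 by lra.
  by rewrite oppr0 expR0; lra.
have t01 : 0 <= h / s <= 1 by rewrite divr_ge0 ?ler_pdivrMr ?mul1r// ltW.
have := @expR_conv R _ (- s) 0 t01; move: t01 => /andP[t0 t1].
have hE : h / s * s = h by rewrite divfK// gt_eqF.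
rewrite mulr0 addr0 mulrN hE expR0.
move: (h / s) t0 t1 hE => t t0 t1 <- conv.
have := mulr_ge0 t0 Ts.
have := mulr_ge0 (_ : 0 <= 1 - t) T0; rewrite subr_ge0 => /(_ t1).
have := ler_wpM2r (ltW qb0) conv.
lra.
Qed.

(** * The relaxed optimum: water filling *)

(** Pouring [\sum_i h i] onto columns of heights [b i]: the volume below level
    [w] is continuous in [w], and at level [s] it does not exceed the available
    volume. *)
Lemma water_level (R : realType) (n : nat) (h b : 'I_n.+1 -> R) (s : R) :
  0 <= s -> (forall i, 0 <= h i) -> (forall i, 0 <= b i) ->
  (forall i, s <= h i + b i) ->
  exists2 w, s <= w & \sum_i Num.max 0 (w - b i) = \sum_i h i.
Proof.
move=> s0 h0 b0 shb.
pose f w : R := \sum_i Num.max 0 (w - b i).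
pose W := \sum_i h i.
have W0 : 0 <= W by apply: sumr_ge0.
have fs : f s <= W.
  by apply: ler_sum => i _; rewrite ge_max h0 lerBlDr; exact: shb.
have fW : W <= f (s + W + b ord0).
  rewrite /f (bigD1 ord0) //= -[leLHS]addr0 lerD//.
    by rewrite le_max addrK lerDr s0 orbT.
  by apply: sumr_ge0 => i _; rewrite le_max lexx.
have cf : {within `[s, s + W + b ord0]%classic, continuous f}.
  apply/continuous_subspaceT/continuous_big => [|i _ x].
    exact: add_continuous.
  apply: (@continuous_max R R (fun=> 0) (fun x => x - b i)).
    exact: cvg_cst.
  by apply: cvgB; [exact: cvg_id|exact: cvg_cst].
have ab : s <= s + W + b ord0 by rewrite -addrA lerDl addr_ge0.
have [|w] := IVT ab cf (v := W).
  by rewrite ge_min fs le_max fW orbT.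
by rewrite in_itv /= => /andP[sw _] fw; exists w.
Qed.

(** The price of an indivisible job of load [x] in the dual of the water
    filling problem at level [w]: the integral over [[0, x]] of
    [Num.min (expR (- w)) (expR (- t))]. Divisible load has unit price
    [expR (- w)]. *)
Definition gain_bound {R : realType} (w x : R) : R :=
  expR (- w) * Num.min x w + (expR (- w) - expR (- Num.max x w)).

Lemma gain_bound0 (R : realType) (w : R) : 0 <= w -> gain_bound w 0 = 0.
Proof. by move=> w0; rewrite /gain_bound min_l// max_r// mulr0 subrr addr0. Qed.

Lemma gain_bound_le (R : realType) (w x : R) :
  0 <= x -> gain_bound w x <= expR (- w) * x.
Proof.
move=> x0; rewrite /gain_bound; have q0 := expR_gt0 (- w).
have [xw|wx] := lerP x w; first by rewrite subrr addr0.
have := expR_ge1Dx (w - x).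
have -> : expR (- x) = expR (- w) * expR (w - x).
  by rewrite -expRD; congr expR; ring.
move=> h; have := ler_wpM2l (ltW q0) h; lra.
Qed.

(** Subadditivity of a concave function vanishing at [0]: it allows several
    indivisible jobs on one machine to be priced separately. *)
Lemma gain_boundD (R : realType) (w x y : R) : 0 <= w -> 0 <= x -> 0 <= y ->
  gain_bound w (x + y) <= gain_bound w x + gain_bound w y.
Proof.
move=> w0; wlog xy : x y / y <= x => [th|x0 y0].
  have [/th//|/ltW xy] := lerP y x => x0 y0.
  by rewrite addrC (addrC (gain_bound w x)); exact: th.
have q0 := expR_gt0 (- w).
have q1 : expR (- w) <= 1 by rewrite expR_le1; lra.
have [xw|wx] := lerP x w; last first.
  have e1 : expR (- y) <= 1 by rewrite expR_le1; lra.
  have ex0 := expR_gt0 (- x); have ey0 := expR_gt0 (- y).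
  have ex : expR (- x) <= expR (- w) by rewrite ler_expR; lra.
  have ew := expR_ge1Dx (- w).
  have ey := expR_ge1Dx (- y).
  rewrite /gain_bound (min_r (ltW wx)) (max_l (ltW wx)).
  have wxy : w <= x + y by lra.
  rewrite (min_r wxy) (max_l wxy).
  rewrite opprD expRD.
  have [yw|wy] := lerP y w.
    have : expR (- x) * (1 - expR (- y)) <= expR (- w) * y.
      by apply: ler_pM; lra.
    lra.
  have eyw : expR (- y) <= expR (- w) by rewrite ler_expR; lra.
  have h1 : expR (- x) * (1 - expR (- y)) <= expR (- w) * (1 - expR (- y)).
    by rewrite ler_wpM2r; lra.
  have h2 : expR (- y) * (1 - expR (- w)) <= expR (- w) * w.
    by apply: ler_pM; lra.
  lra.
have yw : y <= w by lra.
apply: le_trans (gain_bound_le _ _ _ (addr_ge0 x0 y0)) _.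
rewrite /gain_bound (min_l xw) (max_r xw) (min_l yw) (max_r yw); lra.
Qed.

(** Dual feasibility: the price of the load of a machine, plus the constant
    [1 - expR (- w) * (1 + w)], covers what the machine earns. For [x <= w]
    this is the tangent at [w] to the concave [1 - expR (- x)]. *)
Lemma loss_le_gain_bound (R : realType) (w x : R) :
  1 - expR (- x) <= 1 - expR (- w) * (1 + w) + gain_bound w x.
Proof.
rewrite /gain_bound; have q0 := expR_gt0 (- w).
have [xw|wx] := lerP x w; last by lra.
have := expR_ge1Dx (w - x).
have -> : expR (- x) = expR (- w) * expR (w - x).
  by rewrite -expRD; congr expR; ring.
move=> h; have := ler_wpM2l (ltW q0) h; lra.
Qed.

(** Complementary slackness: a machine holding [x], topped up to level [w] with
    divisible load, earns exactly its price plus that constant. *)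
Lemma gain_bound_level (R : realType) (w x : R) :
  gain_bound w x = 1 - expR (- Num.max x w)
    - (1 - expR (- w) * (1 + w)) - expR (- w) * Num.max 0 (w - x).
Proof.
rewrite /gain_bound; have [xw|wx] := lerP x w.
  by rewrite max_r ?subr_ge0//; ring.
by rewrite max_l ?subr_le0 ?ltW//; ring.
Qed.

(** * List scheduling against an arbitrary partition *)

(** [q] is the greedy partition and [o] the competing one. All that the
    argument uses of list scheduling is that no machine without its last job is
    loaded more than another machine; that the two partitions share their jobs
    is used only for one sum, of the prices of the jobs. *)
Lemma balanced_greedy_bound (R : realType) (T : eqType) (n : nat) (c : R)
    (a : T -> R) (q o : 'I_n -> seq T) :
  (0 < n)%N -> 0 < c < 1 ->
  (forall s w, 0 <= s <= w ->
     s * expR (- s) <= (1 - c) * w + c * s * expR (- w)) ->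
  (forall j, 0 <= a j) ->
  (forall i t j, q i = rcons t j ->
     forall i', \sum_(k <- t) a k <= \sum_(k <- q i') a k) ->
  (forall g : T -> R,
     \sum_i \sum_(j <- o i) g j = \sum_i \sum_(j <- q i) g j) ->
  c * (\sum_i (1 - expR (- \sum_(j <- o i) a j)))
    <= \sum_i (1 - expR (- \sum_(j <- q i) a j)).
Proof.
case: n q o => // n q o _ c01 Hc a0 bal same.
pose load i := \sum_(j <- q i) a j.
have load0 i : 0 <= load i by apply: sumr_ge0.
have [i0 _ load_min] := Order.TotalTheory.arg_minP load (erefl : xpredT ord0).
pose h i := if q i is x :: l then \sum_(j <- belast x l) a j else 0.
pose b i := if q i is x :: l then a (last x l) else 0.
have h0 i : 0 <= h i by rewrite /h; case: (q i) => // x l; apply: sumr_ge0.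
have b0 i : 0 <= b i by rewrite /b; case: (q i).
have hb i : load i = h i + b i.
  rewrite /load /h /b; case: (q i) => [|x l]; first by rewrite big_nil addr0.
  by rewrite lastI -cats1 big_cat big_seq1.
have hs i : h i <= load i0.
  rewrite /h; case E: (q i) => [|x l] //.
  by apply: (bal i _ (last x l)); rewrite -lastI.
have shb i : load i0 <= h i + b i by rewrite -hb; exact: load_min.
have [w sw level] := water_level _ _ h b _ (load0 i0) h0 b0 shb.
have w0 : 0 <= w by apply: le_trans sw.
have [nu [nuA nuB nuC]] :=
  multiplier_exists _ c (load i0) w c01 (introT andP (conj (load0 i0) sw))
    (Hc _ _ (introT andP (conj (load0 i0) sw))).
pose mu := expR (- w).
have mu0 : 0 <= mu := expR_ge0 _.
pose K := 1 - mu * (1 + w).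
(* Only the last jobs are treated as indivisible; all others are priced as
   divisible load. *)
pose is_last j := [exists i, if q i is x :: l then j == last x l else false].
pose g j := if is_last j then gain_bound w (a j) else mu * a j.
have g_le j : g j <= mu * a j.
  by rewrite /g; case: ifP => // _; exact: gain_bound_le.
have g_ge j : gain_bound w (a j) <= g j.
  by rewrite /g; case: ifP => // _; exact: gain_bound_le.
have opt i : 1 - expR (- \sum_(j <- o i) a j) <= K + \sum_(j <- o i) g j.
  apply: le_trans (loss_le_gain_bound _ w _) _; rewrite lerD2l.
  elim: (o i) => [|j l IHl]; first by rewrite !big_nil gain_bound0.
  rewrite !big_cons; apply: le_trans (lerD (g_ge j) IHl).
  by apply: gain_boundD => //; apply: sumr_ge0.
have lzf i : K + \sum_(j <- q i) g j
    <= 1 - expR (- Num.max (b i) w) + mu * (h i - Num.max 0 (w - b i)).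
  have -> : 1 - expR (- Num.max (b i) w) + mu * (h i - Num.max 0 (w - b i))
      = K + (mu * h i + gain_bound w (b i)).
    by rewrite gain_bound_level /K /mu; ring.
  rewrite lerD2l /h /b; case E: (q i) => [|x l].
    by rewrite big_nil mulr0 gain_bound0// addr0.
  have gx : g (last x l) = gain_bound w (a (last x l)).
    by rewrite /g; case: ifP => // /existsP[]; exists i; rewrite E.
  rewrite lastI -cats1 big_cat big_seq1 /= gx lerD2r mulr_sumr.
  by apply: ler_sum => j _.
apply: (@le_trans _ _ (c * \sum_i (1 - expR (- Num.max (b i) w)))).
  rewrite ler_pM2l; last by case/andP: c01.
  apply: le_trans (ler_sum _ (fun i _ => opt i)) _.
  rewrite big_split /= same -big_split /=.
  apply: le_trans (ler_sum _ (fun i _ => lzf i)) _.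
  by rewrite big_split /= -mulr_sumr [X in mu * X]sumrB level subrr mulr0 addr0.
rewrite -subr_ge0 mulr_sumr -sumrB.
have -> : \sum_i (1 - expR (- load i) - c * (1 - expR (- Num.max (b i) w)))
   = \sum_i (1 - expR (- (h i + b i)) - c * (1 - expR (- Num.max (b i) w))
        + nu * (Num.max 0 (w - b i) - h i)).
  rewrite [RHS]big_split /= -mulr_sumr [X in nu * X]sumrB level subrr mulr0.
  rewrite addr0.
  by apply: eq_bigr => i _; rewrite hb.
apply: sumr_ge0 => i _; apply: machine_bound nuA nuB nuC => //.
by rewrite h0 hs.
Qed.

(** * Losses on a single machine *)

(** In the induction, the partial sum reached so far, [A], may be carried over
    with the next, smaller weight because it is nonnegative. *)
Lemma abel_sum_ge0 (R : realDomainType) (T : Type) (z d : T -> R) (s : seq T) :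
  sorted (fun j k => z k <= z j) s -> (forall j, 0 <= z j) ->
  (forall n, 0 <= \sum_(j <- take n s) d j) ->
  0 <= \sum_(j <- s) z j * d j.
Proof.
move=> sorted_s z0.
suff acc x u A : path (fun j k => z k <= z j) x u -> 0 <= A ->
    (forall n, 0 <= A + \sum_(j <- take n u) d j) ->
    0 <= z x * A + \sum_(j <- u) z j * d j.
  case: s sorted_s => [|x s] /= sorted_s ps; first by rewrite big_nil.
  rewrite big_cons; apply: acc => // [|n].
    by have := ps 1%N; rewrite /= take0 big_seq1.
  by have := ps n.+1; rewrite /= big_cons.
elim: u x A => [|y u IHu] x A /=.
  by move=> _ A0 _; rewrite big_nil addr0 mulr_ge0.
case/andP=> zyx yu A0 ps; rewrite big_cons.
have Ad : 0 <= A + d y by have := ps 1%N; rewrite /= take0 big_seq1.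
have : 0 <= z y * (A + d y) + \sum_(j <- u) z j * d j.
  by apply: IHu => // n; have := ps n.+1; rewrite /= big_cons addrA.
move: (\sum_(j <- u) _) => S.
have : 0 <= (z x - z y) * A by rewrite mulr_ge0// subr_ge0.
lra.
Qed.

Section SingleMachine.
Variables (T : eqType) (p : T -> rat).
Hypotheses (p_gt0 : forall j, 0 < p j) (p_lt1 : forall j, p j < 1).

Definition cumprob (l : seq T) (j : T) : rat :=
  \prod_(k <- take (index j l).+1 l) p k.

(** [cumprob l j * odds j] is the loss caused by [j]: the cumulative
    probability before [j] minus the one after it. *)
Definition odds (j : T) : rat := (1 - p j) / p j.

Lemma sum_loss_cons (A : pred T) (x : T) (l : seq T) :
  uniq (x :: l) ->
  \sum_(j <- x :: l | A j) cumprob (x :: l) j * odds j =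
    (if A x then 1 - p x else 0)
    + p x * \sum_(j <- l | A j) cumprob l j * odds j.
Proof.
case/andP=> xl ul.
have head : cumprob (x :: l) x * odds x = 1 - p x.
  by rewrite /cumprob /= eqxx take0 big_seq1 mulrC divfK// gt_eqF.
rewrite big_cons head.
have -> : \sum_(j <- l | A j) cumprob (x :: l) j * odds j
    = p x * \sum_(j <- l | A j) cumprob l j * odds j.
  rewrite mulr_sumr big_seq_cond [RHS]big_seq_cond.
  apply: eq_bigr => j /andP[jl _]; rewrite mulrA; congr (_ * _).
  rewrite /cumprob /=; case: eqP => [xj|_]; first by rewrite xj jl in xl.
  by rewrite big_cons.
by case: ifP => // _; rewrite add0r.
Qed.

(** Jobs outside [A] only scale down the losses of the jobs after them; with
    all jobs in [A] the losses telescope. *)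
Lemma sum_loss_le (A : pred T) (l : seq T) : uniq l ->
  0 <= \sum_(j <- l | A j) cumprob l j * odds j
    <= 1 - \prod_(j <- l | A j) p j.
Proof.
elim: l => [|x l IHl] ul; first by rewrite !big_nil subrr lexx.
have /andP[s0 s1] : _ := IHl (proj2 (andP ul)).
rewrite sum_loss_cons// big_cons.
have := p_gt0 x; have := p_lt1 x.
move: (\sum_(j <- l | A j) _) (\prod_(j <- l | A j) _) s0 s1 => s P s0 s1.
by case: ifP => _ px1 px0; apply/andP; split; nra.
Qed.

(** The losses over the initial segment [l1] telescope. *)
Lemma sum_loss_ge (A : pred T) (l1 l2 : seq T) :
  uniq (l1 ++ l2) -> all A l1 ->
  1 - \prod_(j <- l1) p j
    <= \sum_(j <- l1 ++ l2 | A j) cumprob (l1 ++ l2) j * odds j.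
Proof.
elim: l1 => [|x l1 IHl] /= ul.
  by rewrite big_nil subrr; case/andP: (sum_loss_le A _ ul).
case/andP=> Ax Al1; have := IHl (proj2 (andP ul)) Al1.
rewrite sum_loss_cons// Ax big_cons; have := p_gt0 x.
move: (\sum_(j <- _ | A j) _) (\prod_(j <- l1) _) => s P px0 sP.
nra.
Qed.

End SingleMachine.

Arguments cumprob {T}.
Arguments odds {T}.

(** * Losses in schedules and runs of the algorithm *)

Section Schedules.
Variables (R : realType) (I : instance R).
Implicit Types (S q : queues I) (j k : job I) (s : seq (job I)).

Lemma ratr_prob_gt0 j : 0 < ratr (prob j) :> R.
Proof. by rewrite ltr0q prob_gt0. Qed.

Lemma ratr_prob_lt1 j : ratr (prob j) < 1 :> R.
Proof. by rewrite -(rmorph1 ratr) ltr_rat prob_lt1. Qed.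

Lemma schedule_sum (S : queues I) (F : job I -> R) : is_schedule S ->
  \sum_i \sum_(j <- S i) F j = \sum_j F j.
Proof.
case=> uS xS; under eq_bigr do rewrite big_uniq//=.
rewrite (exchange_big_dep xpredT) //=; apply: eq_bigr => j _.
have [i [ij iu]] := xS j.
rewrite (big_pred1 i) // => i'; apply/idP/eqP => [/iu //|-> //].
Qed.

Lemma job_cumprob_queue S i j : is_schedule S -> j \in S i ->
  job_cumprob S j = cumprob (@prob R I) (S i) j.
Proof.
case=> uS xS ji; rewrite /job_cumprob /cumprob big_uniq ?take_uniq//=.
apply: eq_bigl => k; rewrite /up_to.
apply/existsP/idP => [[i' /and3P[ki' ji' kj]]|ki].
  have [i0 [_ iu]] := xS j.
  have ii : i' = i by rewrite -(iu _ ji) (iu _ ji').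
  by rewrite in_take ?ltnS -ii.
exists i; have kS := mem_take ki.
by rewrite kS ji -ltnS -in_take.
Qed.

Definition job_loss S j : R := ratr (job_cumprob S j * odds (@prob R I) j).

Lemma ER_job_loss S :
  ER S = \sum_(j <- lzf_order I) Z_ratio (prob j) (reward j) * job_loss S j.
Proof.
rewrite /ER [RHS]big_uniq ?lzf_order_uniq//=; apply: eq_big => j.
  by rewrite lzf_order_all.
move=> _; rewrite /Z_ratio /job_loss /odds !rmorphM /= fmorphV rmorphB rmorph1.
have p0 := ratr_prob_gt0 j.
have p1 := ratr_prob_lt1 j.
by field; rewrite !gt_eqF// subr_gt0.
Qed.

Lemma sum_job_loss S (A : seq (job I)) : is_schedule S -> uniq A ->
  \sum_(j <- A) job_loss S j =
  \sum_i ratr (\sum_(j <- S i | j \in A)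
                 cumprob (@prob R I) (S i) j * odds (@prob R I) j).
Proof.
move=> schedS uA; rewrite big_uniq//= big_mkcond -(schedule_sum S)//.
apply: eq_bigr => i _; rewrite -big_mkcond rmorph_sum /=.
rewrite big_seq_cond [RHS]big_seq_cond; apply: eq_bigr => j /andP[ji _].
by rewrite /job_loss (job_cumprob_queue _ i).
Qed.

Lemma lzf_run_cat s1 s2 q S : lzf_run (s1 ++ s2) q S ->
  exists2 q', lzf_run s1 q q' & lzf_run s2 q' S.
Proof.
elim: s1 q => [|j s1 IHs] q /=; first by exists q.
by case=> i imax /IHs[q' run1 run2]; exists q' => //; exists i.
Qed.

Lemma lzf_run_prefix s q S i : lzf_run s q S -> exists l, S i = q i ++ l.
Proof.
elim: s q => [|j s IHs] q /=; first by move=> ->; exists [::]; rewrite cats0.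
case=> i0 _ /IHs[l ->]; rewrite ffunE; case: ifP => _; last by exists l.
by exists (j :: l); rewrite cat_rcons.
Qed.

Lemma lzf_run_sum s q S (g : job I -> R) : lzf_run s q S ->
  \sum_i \sum_(j <- S i) g j = \sum_i \sum_(j <- q i) g j + \sum_(j <- s) g j.
Proof.
elim: s q => [|j s IHs] q /=; first by move=> ->; rewrite big_nil addr0.
case=> i _ /IHs ->; rewrite big_cons addrA; congr (_ + _).
rewrite (bigD1 i)//= [in RHS](bigD1 i)//= ffunE eqxx -cats1 big_cat big_seq1 /=.
rewrite addrAC; congr (_ + _ + _); apply: eq_bigr => i' /negPf ne.
by rewrite ffunE ne.
Qed.

(** A job is appended to a machine of least load, and loads never decrease: so
    each machine without its last job has load at most that of every
    machine. *)
Definition balanced q := forall i t j, q i = rcons t j ->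
  forall i', machine_cumprob q i' <= \prod_(k <- t) prob k.

Lemma lzf_run_balanced s q S : balanced q -> lzf_run s q S -> balanced S.
Proof.
elim: s q => [|j s IHs] q bal /=; first by move->.
case=> i imax; apply: IHs => i1 t k E i2.
have decr : machine_cumprob (append q i j) i2 <= machine_cumprob q i2.
  rewrite /machine_cumprob ffunE; case: ifP => // _.
  rewrite -cats1 big_cat big_seq1 /= ler_piMr ?(ltW (prob_lt1 j))//.
  by apply: prodr_ge0 => k' _; rewrite ltW ?prob_gt0.
apply: le_trans decr _; move: E; rewrite ffunE; case: eqP => [->|_].
  by move/rcons_inj => [<- _]; exact: imax.
by move=> E; exact: (bal i1 t k E i2).
Qed.

(** The loads are [- ln] of the success probabilities; the greedy partition is
    the state [q] of the algorithm after the first [n] jobs, and the competing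
    one is [S] with all other jobs removed. *)
Lemma greedy_prefix_bound (c : R) (S_LZF S : queues I) (n : nat) :
  0 < c < 1 ->
  (forall s w : R, 0 <= s <= w ->
     s * expR (- s) <= (1 - c) * w + c * s * expR (- w)) ->
  is_LZF S_LZF -> is_schedule S ->
  c * \sum_(j <- take n (lzf_order I)) job_loss S j
    <= \sum_(j <- take n (lzf_order I)) job_loss S_LZF j.
Proof.
move=> c01 Hc lzf schedS.
have schedL := is_LZF_schedule lzf; set A := take n _.
have uA : uniq A by rewrite take_uniq ?lzf_order_uniq.
have := lzf; rewrite /is_LZF -(cat_take_drop n (lzf_order I)).
case/lzf_run_cat => q run1 run2.
have q_sum (g : job I -> R) : \sum_i \sum_(j <- q i) g j = \sum_(j <- A) g j.
  rewrite (lzf_run_sum _ _ _ _ run1) big1 ?add0r// => i _.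
  by rewrite ffunE big_nil.
(* A job outside [A] does not occur in [q]: apply [q_sum] to its indicator. *)
have qA i : all (mem A) (q i).
  apply/allP => j ji; apply/negPn/negP => jA.
  have := q_sum (fun k => (k == j)%:R).
  rewrite [RHS]big_seq [RHS]big1 => [|k kA]; last first.
    by case: eqVneq kA => // -> kA; move: jA; rewrite inE kA.
  move/eqP; rewrite psumr_eq0; last by move=> i' _; apply: sumr_ge0.
  move/allP => /(_ i (mem_index_enum _)) /=.
  rewrite psumr_eq0// => /allP /(_ j ji) /=.
  by rewrite eqxx oner_eq0.
pose a j : R := - ln (ratr (prob j)).
have expRa l : expR (- \sum_(j <- l) a j) = ratr (\prod_(j <- l) prob j).
  rewrite -sumrN expR_sum rmorph_prod; apply: eq_bigr => j _.
  by rewrite opprK lnK ?posrE ?ratr_prob_gt0.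
have a0 j : 0 <= a j.
  by rewrite /a oppr_ge0 ln_le0// ltW// ratr_prob_lt1.
pose o i := [seq j <- S i | j \in A].
have bal : balanced q.
  by apply: (lzf_run_balanced _ _ _ _ run1) => i t j; rewrite ffunE; case: t.
have n0 := machines_gt0 I.
have bal_a i t j : q i = rcons t j ->
    forall i', \sum_(k <- t) a k <= \sum_(k <- q i') a k.
  move=> E i'; rewrite -lerN2 -ler_expR !expRa ler_rat; exact: bal E i'.
have same (g : job I -> R) :
    \sum_i \sum_(j <- o i) g j = \sum_i \sum_(j <- q i) g j.
  rewrite q_sum [RHS]big_uniq//= [RHS]big_mkcond -(schedule_sum S)//.
  by apply: eq_bigr => i _; rewrite big_filter big_mkcond.
have key := balanced_greedy_bound _ _ _ c a q o n0 c01 Hc a0 bal_a same.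
rewrite !sum_job_loss//.
apply: (@le_trans _ _ (c * (\sum_i (1 - expR (- \sum_(j <- o i) a j))))).
  rewrite ler_pM2l; last by case/andP: c01.
  apply: ler_sum => i _.
  rewrite expRa /o big_filter -(rmorph1 ratr) -rmorphB ler_rat.
  have /andP[] // := sum_loss_le _ _ (@prob_gt0 R I) (@prob_lt1 R I)
    (mem A) (S i) (schedS.1 i).
apply: le_trans key _; apply: ler_sum => i _.
rewrite expRa -(rmorph1 ratr) -rmorphB ler_rat.
have [l E] := lzf_run_prefix _ _ _ i run2.
rewrite E; apply: sum_loss_ge => //.
- exact: prob_gt0.
- exact: prob_lt1.
- by rewrite -E; exact: schedL.1.
Qed.

End Schedules.

(** * The approximation ratio *)

(** The ratio at [x = w / s] and [p = expR (- s)]. *)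
Lemma chord_exp (R : realType) (c s w : R) :
  c < 1 -> lbound (@ratio_values R) c -> 0 <= s <= w ->
  s * expR (- s) <= (1 - c) * w + c * s * expR (- w).
Proof.
move=> c1 clb /andP[]; rewrite le_eqVlt => /orP[/eqP <- w0|s0 sw].
  by rewrite mulr0 !mul0r addr0 mulr_ge0// subr_ge0 ltW.
have x1 : 1 <= w / s by rewrite ler_pdivlMr// mul1r.
have p01 : 0 < expR (- s) < 1 by rewrite expR_gt0 expR_lt1 oppr_lt0.
have : c <= (w / s - expR (- s)) / (w / s - expR (- s) `^ (w / s)).
  by apply: clb; exists (w / s), (expR (- s)).
rewrite ratio_ge// -expRM -(ler_pM2l s0).
have -> : - s * (w / s) = - w by field; rewrite gt_eqF.
have -> // : s * ((1 - c) * (w / s) + c * expR (- w))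
  = (1 - c) * w + c * s * expR (- w) by field; rewrite gt_eqF.
Qed.

Lemma ER_gt0 (R : realType) (I : instance R) (S : queues I) : 0 < ER S.
Proof.
have [j rj] := reward_neq0 I.
have P0 k : 0 < ratr (job_cumprob S k) :> R.
  by rewrite ltr0q prodr_gt0// => k' _; exact: prob_gt0.
rewrite /ER (bigD1 j)//= ltr_wpDr//.
  by apply: sumr_ge0 => k _; rewrite mulr_ge0 ?reward_ge0 ?(ltW (P0 k)).
by rewrite mulr_gt0// lt_def rj reward_ge0.
Qed.

Theorem theorem3p4 (R : realType) :
  exists c : R,
    [/\ is_min (@ratio_values R) c,
        853195%:R / 10 ^+ 6 <= c < 853196%:R / 10 ^+ 6
      & forall (I : instance R) (S_LZF S_OPT : queues I),
          is_LZF S_LZF -> is_optimal S_OPT -> c <= lambda S_LZF S_OPT].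
Proof.
have [c [[cval clb] cub]] := ratio_values_has_min R.
have clow : 853195%:R / 10 ^+ 6 <= c.
  case: cval => x [p [x1 p01 ->]]; rewrite ratio_ge//.
  exact: powR_chord_numeric.
have c01 : 0 < c < 1 by apply/andP; split; lra.
exists c; split=> //; first by rewrite clow cub.
move=> I S_LZF S_OPT lzf [sched _].
have Hc s w := chord_exp R c s w (proj2 (andP c01)) clb.
rewrite /lambda ler_pdivlMr ?ER_gt0// -subr_ge0 !ER_job_loss mulr_sumr -sumrB.
pose z j := Z_ratio (@prob R I j) (reward j).
pose d j := job_loss R I S_LZF j - c * job_loss R I S_OPT j.
rewrite (eq_bigr (fun j => z j * d j)); last first.
  by move=> j _; rewrite /z /d; ring.
apply: abel_sum_ge0; first exact: lzf_order_sorted.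
  move=> j; apply: divr_ge0.
    exact: mulr_ge0 (ltW (ratr_prob_gt0 _ _ j)) (reward_ge0 j).
  by rewrite subr_ge0 (ltW (ratr_prob_lt1 _ _ j)).
move=> n; rewrite sumrB -mulr_sumr subr_ge0.
exact: greedy_prefix_bound.
Qed.
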